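(* Let $\varPhi\subset\mathbb{E}^3$ be a skew ruled surface with a polar normalization $\overline{y}$, and let $q$ be its support function. The rotation $\mathrm{curl}^G\overline{Q}$ of the support vector field $\overline{Q}$ with respect to the relative metric $G$ of $\varPhi$ vanishes identically, and its potential is given by $$\tau(u,v)=\frac{1}{4q}+c,\qquad c\in\mathbb{R}.$$
   Context: $\varPhi=(U,\overline{x})$ is a ruled $C^r$-surface ($r\ge 3$) of nonvanishing Gaussian curvature in Euclidean space $\mathbb{E}^3$, given by an injective $C^r$-immersion on $U=I\times\mathbb{R}$ ($I\subset\mathbb{R}$ an open interval) in standard parameters $u^1=u\in I$, $u^2=v\in\mathbb{R}$: $\overline{x}(u,v)=\overline{s}(u)+v\,\overline{e}(u)$, $|\overline{e}|=|\overline{e}'|=1$, $\langle\overline{s}',\overline{e}'\rangle=0$, where $'=d/du$. Put $\overline{n}=\overline{e}'$, $\overline{z}=\overline{e}\times\overline{n}$. The fundamental invariants are $\delta(u)=(\overline{s}',\overline{e},\overline{e}')$ (distribution parameter, nowhere zero), $\kappa(u)=(\overline{e},\overline{e}',\overline{e}'')$ (conical curvature), and $\lambda(u)=\cot\sigma$, where $\sigma=\sphericalangle(\overline{e},\overline{s}')$ is the striction ($-\pi/2<\sigma\le\pi/2$, $\mathrm{sign}\,\sigma=\mathrm{sign}\,\delta$), so that $\overline{e}'=\overline{n}$, $\overline{n}'=-\overline{e}+\kappa\overline{z}$, $\overline{z}'=-\kappa\overline{n}$, $\overline{s}'=\delta\lambda\overline{e}+\delta\overline{z}$. Let $w=\sqrt{\delta^2+v^2}$;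 the unit normal is $\overline{\xi}=(\delta\overline{n}-v\overline{z})/w$. A subscript $/i$ denotes the partial derivative with respect to $u^i$. A relative normalization of $\varPhi$ is a $C^s$-map $\overline{y}:U\to\mathbb{R}^3$, $1\le s<r$, such that at every point $\{\overline{x}_{/1},\overline{x}_{/2},\overline{y}\}$ has rank 3 and $\{\overline{x}_{/1},\overline{x}_{/2},\overline{y}_{/i}\}$ has rank 2 for $i=1,2$. Its support function is $q=\langle\overline{\xi},\overline{y}\rangle$, which never vanishes on $U$ and determines $\overline{y}$ uniquely. The normalization is called polar if at each point $\overline{y}(u,v)$ lies in the span of $\overline{n}(u),\overline{z}(u)$ (the polar plane); equivalently $q=f(V)$ with $f$ a $C^2$-function of $$V=\arctan\frac{v}{\delta}-\int\kappa\,du$$ ($\int\kappa\,du$ a fixed antiderivative of $\kappa$). The relative metric $G$ has coefficients $G_{ij}=q^{-1}h_{ij}$, where $h_{ij}$ are the coefficients of the second fundamental form: $h_{11}=-(\kappa w^2+\delta'v-\delta^2\lambda)/w$, $h_{12}=\delta/w$, $h_{22}=0$; $G^{(ij)}$ denotes the inverse matrix. The support vector field is $\overline{Q}=\tfrac14\nabla^G(\tfrac1q,\overline{x})$, where $\nabla^G(f,\overline{x})=G^{(ij)}f_{/i}\,\overline{x}_{/j}$ is the first Beltrami operator of $G$; that is, $\overline{Q}=Q^i\overline{x}_{/i}$ with $Q^i=\tfrac14G^{(ij)}(1/q)_{/j}$. Its rotation with respect to $G$ is $$\mathrm{curl}^G\overline{Q}=\frac{(G_{12}Q^1+G_{22}Q^2)_{/1}-(G_{11}Q^1+G_{12}Q^2)_{/2}}{|\det(G_{ij})|^{1/2}}.$$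 A potential of $\overline{Q}$ (with respect to $G$) is a function $\tau$ with $Q^i=G^{(ij)}\tau_{/j}$, i.e. $\overline{Q}$ is the $G$-gradient of $\tau$. *)

(* Defs.v *)
From Stdlib Require Import Reals.
From Coquelicot Require Import Coquelicot.
Open Scope R_scope.

(* Sums and multiples of vectors are Coquelicot's [plus] and [scal]. *)
Definition vec : Type := (R * R * R)%type.

Definition c1 (a : vec) : R := fst (fst a).
Definition c2 (a : vec) : R := snd (fst a).
Definition c3 (a : vec) : R := snd a.

Definition dot (a b : vec) : R := c1 a * c1 b + c2 a * c2 b + c3 a * c3 b.

Definition vnorm (a : vec) : R := sqrt (dot a a).

Definition cross (a b : vec) : vec :=
  (c2 a * c3 b - c3 a * c2 b,
   c3 a * c1 b - c1 a * c3 b,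
   c1 a * c2 b - c2 a * c1 b).

Definition triple (a b c : vec) : R := dot a (cross b c).

Definition lin_indep2 (a b : vec) : Prop :=
  forall p q : R, plus (scal p a) (scal q b) = zero -> p = 0 /\ q = 0.

Definition lin_indep3 (a b c : vec) : Prop :=
  forall p q t : R,
    plus (plus (scal p a) (scal q b)) (scal t c) = zero ->
    p = 0 /\ q = 0 /\ t = 0.

Definition rank_3 (a b c : vec) : Prop := lin_indep3 a b c.

Definition rank_2 (a b c : vec) : Prop :=
  ~ lin_indep3 a b c /\
  (lin_indep2 a b \/ lin_indep2 a c \/ lin_indep2 b c).

Definition vDerive (f : R -> vec) (u : R) : vec :=
  (Derive (fun t => c1 (f t)) u,
   Derive (fun t => c2 (f t)) u,
   Derive (fun t => c3 (f t)) u).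

(* The two coordinate indices: [i1] stands for u and [i2] for v. *)
Inductive idx : Set := i1 | i2.

Definition sum_idx (F : idx -> R) : R := F i1 + F i2.

Definition partial (i : idx) (f : R -> R -> R) (u v : R) : R :=
  match i with
  | i1 => Derive (fun t => f t v) u
  | i2 => Derive (fun t => f u t) v
  end.

(* [Derive] is total, so existence of partial derivatives is a separate
   condition. *)
Definition ex_partial (i : idx) (f : R -> R -> R) (u v : R) : Prop :=
  match i with
  | i1 => ex_derive (fun t => f t v) u
  | i2 => ex_derive (fun t => f u t) v
  end.

Definition vpartial (i : idx) (f : R -> R -> vec) (u v : R) : vec :=
  (partial i (fun u v => c1 (f u v)) u v,
   partial i (fun u v => c2 (f u v)) u v,
   partial i (fun u v => c3 (f u v)) u v).

(* U is meant to be open; continuity of the lower derivatives follows from the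
   existence and continuity of those of the next order. *)
Fixpoint Ck (k : nat) (U : R -> R -> Prop) (f : R -> R -> R) : Prop :=
  match k with
  | O => forall u v, U u v -> continuity_2d_pt f u v
  | S k' =>
      forall i : idx,
        (forall u v, U u v -> ex_partial i f u v) /\ Ck k' U (partial i f)
  end.

Definition vCk (k : nat) (U : R -> R -> Prop) (f : R -> R -> vec) : Prop :=
  Ck k U (fun u v => c1 (f u v)) /\
  Ck k U (fun u v => c2 (f u v)) /\
  Ck k U (fun u v => c3 (f u v)).

(* U = I x R, where I is the open interval ]a, b[ with possibly infinite
   endpoints. *)
Definition strip (a b : Rbar) (u v : R) : Prop := Rbar_lt a u /\ Rbar_lt u b.

Section RuledSurface.

(* s is the striction curve and e the unit vector field along the rulings. *)
Variables s e : R -> vec.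

Definition surf (u v : R) : vec := plus (s u) (scal v (e u)).

Definition nvec (u : R) : vec := vDerive e u.
Definition zvec (u : R) : vec := cross (e u) (nvec u).

Definition distr (u : R) : R := triple (vDerive s u) (e u) (vDerive e u).

Definition w (u v : R) : R := sqrt (distr u ^ 2 + v ^ 2).

(* This is the normalized cross product of the partial derivatives of the
   surface by u and v, in standard parameters. *)
Definition unit_normal (u v : R) : vec :=
  scal (/ w u v) (minus (scal (distr u) (nvec u)) (scal v (zvec u))).

Definition fund1 (i j : idx) (u v : R) : R :=
  dot (vpartial i surf u v) (vpartial j surf u v).

Definition fund2 (i j : idx) (u v : R) : R :=
  dot (unit_normal u v) (vpartial j (vpartial i surf) u v).

Definition det2 (A : idx -> idx -> R -> R -> R) (u v : R) : R :=
  A i1 i1 u v * A i2 i2 u v - A i1 i2 u v * A i2 i1 u v.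

Definition gauss_curv (u v : R) : R := det2 fund2 u v / det2 fund1 u v.

Record skew_ruled_surface (r : nat) (a b : Rbar) : Prop := {
  srs_interval : Rbar_lt a b;
  srs_smooth : vCk r (strip a b) surf;
  srs_injective : forall u v u' v',
    strip a b u v -> strip a b u' v' -> surf u v = surf u' v' ->
    u = u' /\ v = v';
  srs_immersion : forall u v, strip a b u v ->
    lin_indep2 (vpartial i1 surf u v) (vpartial i2 surf u v);
  srs_e_unit : forall u, Rbar_lt a u -> Rbar_lt u b -> vnorm (e u) = 1;
  srs_e'_unit : forall u, Rbar_lt a u -> Rbar_lt u b ->
    vnorm (vDerive e u) = 1;
  srs_striction : forall u, Rbar_lt a u -> Rbar_lt u b ->
    dot (vDerive s u) (vDerive e u) = 0;
  srs_curvature : forall u v, strip a b u v -> gauss_curv u v <> 0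
}.

Record relative_normalization (k : nat) (a b : Rbar) (y : R -> R -> vec)
  : Prop := {
  rn_smooth : vCk k (strip a b) y;
  rn_transversal : forall u v, strip a b u v ->
    rank_3 (vpartial i1 surf u v) (vpartial i2 surf u v) (y u v);
  rn_tangent : forall (i : idx) u v, strip a b u v ->
    rank_2 (vpartial i1 surf u v) (vpartial i2 surf u v) (vpartial i y u v)
}.

Definition polar (a b : Rbar) (y : R -> R -> vec) : Prop :=
  forall u v, strip a b u v ->
    exists p t : R, y u v = plus (scal p (nvec u)) (scal t (zvec u)).

Variable y : R -> R -> vec.

Definition support (u v : R) : R := dot (unit_normal u v) (y u v).

Definition relG (i j : idx) (u v : R) : R := / support u v * fund2 i j u v.

Definition relG_inv (i j : idx) (u v : R) : R :=
  match i, j with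
  | i1, i1 => relG i2 i2 u v / det2 relG u v
  | i1, i2 => - relG i1 i2 u v / det2 relG u v
  | i2, i1 => - relG i2 i1 u v / det2 relG u v
  | i2, i2 => relG i1 i1 u v / det2 relG u v
  end.

(* Tangent vector fields are given by their components with respect to the
   partial derivatives of the surface. *)

Definition grad_G (f : R -> R -> R) (i : idx) (u v : R) : R :=
  sum_idx (fun j => relG_inv i j u v * partial j f u v).

Definition Q (i : idx) (u v : R) : R :=
  / 4 * grad_G (fun u v => 1 / support u v) i u v.

Definition lower_G (X : idx -> R -> R -> R) (i : idx) (u v : R) : R :=
  sum_idx (fun j => relG i j u v * X j u v).

Definition curl_G (X : idx -> R -> R -> R) (u v : R) : R :=
  (partial i1 (lower_G X i2) u v - partial i2 (lower_G X i1) u v)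
  / sqrt (Rabs (det2 relG u v)).

Definition curl_exists (X : idx -> R -> R -> R) (u v : R) : Prop :=
  ex_partial i1 (lower_G X i2) u v /\ ex_partial i2 (lower_G X i1) u v.

Definition is_potential (a b : Rbar) (X : idx -> R -> R -> R)
    (tau : R -> R -> R) : Prop :=
  forall (i : idx) u v, strip a b u v ->
    ex_partial i tau u v /\ X i u v = grad_G tau i u v.

End RuledSurface.

(* Main.v *)
(* The support vector field is by definition the [G]-gradient of [1 / (4 q)], so
   its covariant components are the partial derivatives of that function, and
   the curl vanishes by the symmetry of mixed second derivatives.  The point is
   that [q] is C^2 even when [y] is only C^1: as the derivatives of [y] are
   tangential, [q_i = <xi_i, y>], and the unit normal [xi] is C^2.  Two
   potentials have the same partial derivatives, hence differ by a constant. *)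

From Stdlib Require Import Reals Lra Lia.
From Coquelicot Require Import Coquelicot.
(* Required last: [c1] would otherwise be the field of Stdlib's [C1_fun]. *)
Require Import Defs.
Open Scope R_scope.

(** * Partial derivatives and the calculus of [Ck] functions on open plane sets *)

Definition open_2d (U : R -> R -> Prop) : Prop :=
  forall u v, U u v -> locally_2d U u v.

(** Openness turns equality on [U] into equality near the point along each coordinate line, which is
    all that a partial derivative sees. *)
Lemma partial_ext_on (U : R -> R -> Prop) (i : idx) (f g : R -> R -> R)
    (u v : R) :
  open_2d U -> (forall u v, U u v -> f u v = g u v) -> U u v ->
  (ex_partial i f u v -> ex_partial i g u v) /\
  partial i f u v = partial i g u v.
Proof.
intros HU Hfg Huv; specialize (HU u v Huv).
destruct i; simpl.
- apply locally_2d_1d_const_y in HU.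
  assert (H : locally u (fun t => f t v = g t v))
    by (revert HU; apply filter_imp; auto).
  split.
  + now apply ex_derive_ext_loc.
  + now apply Derive_ext_loc.
- apply locally_2d_1d_const_x in HU.
  assert (H : locally v (fun t => f u t = g u t))
    by (revert HU; apply filter_imp; auto).
  split.
  + now apply ex_derive_ext_loc.
  + now apply Derive_ext_loc.
Qed.

Lemma partial_plus (i : idx) (f g : R -> R -> R) (u v : R) :
  ex_partial i f u v -> ex_partial i g u v ->
  ex_partial i (fun u v => f u v + g u v) u v /\
  partial i (fun u v => f u v + g u v) u v = partial i f u v + partial i g u v.
Proof.
destruct i; simpl; intros Hf Hg.
- split; [exact (ex_derive_plus (fun t => f t v) (fun t => g t v) u Hf Hg)
         | now apply (Derive_plus (fun t => f t v) (fun t => g t v))].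
- split; [exact (ex_derive_plus (fun t => f u t) (fun t => g u t) v Hf Hg)
         | now apply (Derive_plus (fun t => f u t) (fun t => g u t))].
Qed.

Lemma partial_mult (i : idx) (f g : R -> R -> R) (u v : R) :
  ex_partial i f u v -> ex_partial i g u v ->
  ex_partial i (fun u v => f u v * g u v) u v /\
  partial i (fun u v => f u v * g u v) u v =
    partial i f u v * g u v + f u v * partial i g u v.
Proof.
destruct i; simpl; intros Hf Hg.
- split; [exact (ex_derive_mult (fun t => f t v) (fun t => g t v) u Hf Hg)
         | now apply (Derive_mult (fun t => f t v) (fun t => g t v))].
- split; [exact (ex_derive_mult (fun t => f u t) (fun t => g u t) v Hf Hg)
         | now apply (Derive_mult (fun t => f u t) (fun t => g u t))].
Qed.

Lemma partial_const (i : idx) (c u v : R) :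
  ex_partial i (fun _ _ => c) u v /\ partial i (fun _ _ => c) u v = 0.
Proof.
destruct i; simpl; (split; [apply ex_derive_const | apply Derive_const]).
Qed.

Lemma partial_comp (i : idx) (phi : R -> R) (f : R -> R -> R) (u v d : R) :
  is_derive phi (f u v) d -> ex_partial i f u v ->
  ex_partial i (fun u v => phi (f u v)) u v /\
  partial i (fun u v => phi (f u v)) u v = d * partial i f u v.
Proof.
intros Hphi.
assert (Hex : ex_derive phi (f u v)) by now exists d.
apply is_derive_unique in Hphi.
destruct i; simpl; intros Hf; (split; [now apply ex_derive_comp|]).
- rewrite (Derive_comp phi (fun t => f t v) u Hex Hf), <- Hphi; ring.
- rewrite (Derive_comp phi (fun t => f u t) v Hex Hf), <- Hphi; ring.
Qed.

Lemma Ck_ext (k : nat) (U : R -> R -> Prop) (f g : R -> R -> R) :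
  open_2d U -> (forall u v, U u v -> f u v = g u v) -> Ck k U f -> Ck k U g.
Proof.
intros HU; revert f g; induction k as [|k IH]; intros f g Hfg; simpl.
- intros Hf u v Huv.
  apply continuity_2d_pt_ext_loc with f; [|now apply Hf].
  destruct (HU u v Huv) as [d Hd].
  exists d; intros; apply Hfg; now apply Hd.
- intros Hf i; destruct (Hf i) as [Hex Hd]; split.
  + intros u v Huv; apply (partial_ext_on U i f g u v HU Hfg Huv); auto.
  + apply (IH (partial i f)); trivial.
    intros u v Huv; apply (partial_ext_on U i f g u v HU Hfg Huv).
Qed.

(** Such an [f] is even differentiable: the partial derivative in u exists near the point and is
    continuous there, and the one in v exists at the point. *)
Lemma Ck_1_continuous (U : R -> R -> Prop) (f : R -> R -> R) (u v : R) :
  open_2d U -> Ck 1 U f -> U u v -> continuity_2d_pt f u v.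
Proof.
intros HU Hf Huv.
destruct (Hf i1) as [Hex1 Hc1]; destruct (Hf i2) as [Hex2 Hc2].
apply continuity_2d_pt_filterlim.
apply (filterdiff_continuous (fun z : R * R => f (fst z) (snd z)) (u, v)).
eexists; apply (is_derive_filterdiff f u v (partial i1 f) (partial i2 f u v)).
- apply (proj1 (locally_2d_locally
    (fun u v => is_derive (fun z => f z v) u (partial i1 f u v)) u v)).
  destruct (HU u v Huv) as [d Hd]; exists d; intros u' v' Hu Hv.
  apply (Derive_correct (fun z => f z v')), (Hex1 u' v'); auto.
- apply (Derive_correct (fun z => f u z)), (Hex2 u v Huv).
- apply (proj1 (continuity_2d_pt_filterlim (partial i1 f) u v)), Hc1, Huv.
Qed.

Lemma Ck_S_Ck (k : nat) (U : R -> R -> Prop) (f : R -> R -> R) :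
  open_2d U -> Ck (S k) U f -> Ck k U f.
Proof.
intros HU; revert f; induction k as [|k IH]; intros f Hf.
- intros u v Huv; now apply (Ck_1_continuous U).
- intros i; destruct (Hf i) as [Hex Hd]; split; [exact Hex|].
  now apply IH.
Qed.

Lemma Ck_le (k n : nat) (U : R -> R -> Prop) (f : R -> R -> R) :
  open_2d U -> (k <= n)%nat -> Ck n U f -> Ck k U f.
Proof.
intros HU Hkn; induction Hkn as [|n Hkn IH]; trivial.
intros Hf; apply IH; now apply Ck_S_Ck.
Qed.

Lemma Ck_const (k : nat) (U : R -> R -> Prop) (c : R) :
  open_2d U -> Ck k U (fun _ _ => c).
Proof.
intros HU; revert c; induction k as [|k IH]; intros c.
- intros u v _; apply continuity_2d_pt_const.
- intros i; split; [intros; apply partial_const|].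
  apply (Ck_ext k U (fun _ _ => 0)); auto.
  intros; symmetry; apply partial_const.
Qed.

Lemma Ck_coord2 (k : nat) (U : R -> R -> Prop) :
  open_2d U -> Ck k U (fun _ v => v).
Proof.
intros HU; destruct k as [|k].
- intros u v _; apply continuity_2d_pt_id2.
- intros [|]; split.
  + intros u v _; exact (ex_derive_const v u).
  + apply (Ck_ext k U (fun _ _ => 0)); auto using Ck_const.
    intros; symmetry; simpl; apply Derive_const.
  + intros u v _; exact (ex_derive_id v).
  + apply (Ck_ext k U (fun _ _ => 1)); auto using Ck_const.
    intros; symmetry; simpl; apply Derive_id.
Qed.

Lemma Ck_plus (k : nat) (U : R -> R -> Prop) (f g : R -> R -> R) :
  open_2d U -> Ck k U f -> Ck k U g -> Ck k U (fun u v => f u v + g u v).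
Proof.
intros HU; revert f g; induction k as [|k IH]; intros f g Hf Hg.
- intros u v Huv; apply continuity_2d_pt_plus; auto.
- intros i; destruct (Hf i) as [Hf1 Hf2]; destruct (Hg i) as [Hg1 Hg2]; split.
  + intros u v Huv; apply partial_plus; auto.
  + apply (Ck_ext k U (fun u v => partial i f u v + partial i g u v)); auto.
    intros u v Huv; symmetry; apply partial_plus; auto.
Qed.

Lemma Ck_mult (k : nat) (U : R -> R -> Prop) (f g : R -> R -> R) :
  open_2d U -> Ck k U f -> Ck k U g -> Ck k U (fun u v => f u v * g u v).
Proof.
intros HU; revert f g; induction k as [|k IH]; intros f g Hf Hg.
- intros u v Huv; apply continuity_2d_pt_mult; auto.
- intros i; destruct (Hf i) as [Hf1 Hf2]; destruct (Hg i) as [Hg1 Hg2]; split.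
  + intros u v Huv; apply partial_mult; auto.
  + apply (Ck_ext k U
      (fun u v => partial i f u v * g u v + f u v * partial i g u v)); trivial.
    * intros u v Huv; symmetry; apply partial_mult; auto.
    * apply Ck_plus; trivial; apply IH; trivial; now apply Ck_S_Ck.
Qed.

Lemma Ck_opp (k : nat) (U : R -> R -> Prop) (f : R -> R -> R) :
  open_2d U -> Ck k U f -> Ck k U (fun u v => - f u v).
Proof.
intros HU Hf.
apply (Ck_ext k U (fun u v => -1 * f u v)); trivial.
- intros; ring.
- apply Ck_mult; auto using Ck_const.
Qed.

Lemma Ck_minus (k : nat) (U : R -> R -> Prop) (f g : R -> R -> R) :
  open_2d U -> Ck k U f -> Ck k U g -> Ck k U (fun u v => f u v - g u v).
Proof. intros; apply Ck_plus; auto using Ck_opp. Qed.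

(** The derivative - (1/f)^2 f_i is a polynomial in 1/f and f_i, so the induction hypothesis for 1/f
    gives one order more. The square root below is treated in the same way, with derivative f_i / (2
    sqrt f). *)
Lemma Ck_inv (k : nat) (U : R -> R -> Prop) (f : R -> R -> R) :
  open_2d U -> (forall u v, U u v -> f u v <> 0) -> Ck k U f ->
  Ck k U (fun u v => / f u v).
Proof.
intros HU Hnz; induction k as [|k IH]; intros Hf.
- intros u v Huv; apply continuity_2d_pt_inv; auto.
- pose proof (Ck_S_Ck k U f HU Hf) as Hfk.
  assert (Hinv : forall u v, U u v ->
    is_derive Rinv (f u v) (- (/ f u v * / f u v))).
  { intros u v Huv; auto_derive; [auto | field; auto]. }
  intros i; destruct (Hf i) as [Hex Hd]; split.
  + intros u v Huv; eapply partial_comp; eauto.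
  + apply (Ck_ext k U
      (fun u v => - (/ f u v * / f u v) * partial i f u v)); trivial.
    * intros u v Huv; symmetry.
      apply (partial_comp i Rinv f u v); auto.
    * auto 8 using Ck_mult, Ck_opp.
Qed.

Lemma Ck_sqrt (k : nat) (U : R -> R -> Prop) (f : R -> R -> R) :
  open_2d U -> (forall u v, U u v -> 0 < f u v) -> Ck k U f ->
  Ck k U (fun u v => sqrt (f u v)).
Proof.
intros HU Hpos; induction k as [|k IH]; intros Hf.
- intros u v Huv; apply continuity_1d_2d_pt_comp; auto.
  apply sqrt_continuity_pt; auto.
- pose proof (Ck_S_Ck k U f HU Hf) as Hfk.
  assert (Hsqrt : forall u v, U u v ->
    is_derive sqrt (f u v) (/ (2 * sqrt (f u v)))).
  { intros u v Huv; apply is_derive_Reals, derivable_pt_lim_sqrt; auto. }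
  intros i; destruct (Hf i) as [Hex Hd]; split.
  + intros u v Huv; eapply partial_comp; eauto.
  + apply (Ck_ext k U
      (fun u v => / (2 * sqrt (f u v)) * partial i f u v)); trivial.
    * intros u v Huv; symmetry.
      apply (partial_comp i sqrt f u v); auto.
    * apply Ck_mult; trivial; apply Ck_inv; trivial.
      -- intros u v Huv; specialize (sqrt_lt_R0 _ (Hpos u v Huv)); lra.
      -- apply Ck_mult; auto using Ck_const.
Qed.

Lemma Ck_schwarz (U : R -> R -> Prop) (f : R -> R -> R) (u v : R) :
  open_2d U -> Ck 2 U f -> U u v ->
  partial i1 (partial i2 f) u v = partial i2 (partial i1 f) u v.
Proof.
intros HU Hf Huv.
destruct (Hf i1) as [Hex1 Hd1]; destruct (Hf i2) as [Hex2 Hd2].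
destruct (Hd1 i2) as [Hex12 Hc12]; destruct (Hd2 i1) as [Hex21 Hc21].
apply (Schwarz f u v).
- destruct (HU u v Huv) as [d Hd]; exists d; intros u' v' Hu Hv.
  specialize (Hd u' v' Hu Hv); repeat split.
  + exact (Hex1 u' v' Hd).
  + exact (Hex2 u' v' Hd).
  + exact (Hex21 u' v' Hd).
  + exact (Hex12 u' v' Hd).
- exact (Hc21 u v Huv).
- exact (Hc12 u v Huv).
Qed.

(** * The strip: openness, slices, and functions determined by their partial derivatives *)

Lemma strip_open (a b : Rbar) : open_2d (strip a b).
Proof.
intros u v [Ha Hb].
assert (H : locally u (fun t => Rbar_lt a t /\ Rbar_lt t b))
  by (apply (locally_interval _ u a b); auto).
destruct H as [d Hd]; exists d; intros u' v' Hu _.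
exact (Hd u' Hu).
Qed.

(** The strip restricts only u, so (u, v0) lies in it whenever (u, v) does. Slices serve to separate
    the two curves that make up a ruled surface. *)
Lemma Ck_slice (k : nat) (a b : Rbar) (f : R -> R -> R) (v0 : R) :
  Ck k (strip a b) f -> Ck k (strip a b) (fun u _ => f u v0).
Proof.
revert f; induction k as [|k IH]; intros f Hf.
- intros u v Huv eps.
  destruct (Hf u v0 Huv eps) as [d Hd]; exists d; intros u' v' Hu _.
  apply Hd; trivial.
  rewrite Rminus_diag; destruct d; simpl; rewrite Rabs_R0; trivial.
- intros [|]; split.
  + intros u v Huv; destruct (Hf i1) as [Hex _]; exact (Hex u v0 Huv).
  + destruct (Hf i1) as [_ Hd]; exact (IH _ Hd).
  + intros u v Huv; exact (ex_derive_const (f u v0) v).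
  + apply (Ck_ext k _ (fun _ _ => 0));
      auto using Ck_const, strip_open.
    intros; symmetry; simpl; apply Derive_const.
Qed.

(** The two points are joined by a segment in the u-direction followed by one in the v-direction;
    the first stays in the strip because I is an interval. *)
Lemma partial_zero_const (a b : Rbar) (g : R -> R -> R) :
  (forall i u v, strip a b u v -> ex_partial i g u v /\ partial i g u v = 0) ->
  forall u v u' v', strip a b u v -> strip a b u' v' -> g u v = g u' v'.
Proof.
intros Hg.
(* The endpoints come in no particular order, hence [Rmin] and [Rmax]. *)
assert (line : forall (f : R -> R) (x y : R),
  (forall t, Rmin x y <= t <= Rmax x y -> is_derive f t 0) -> f x = f y).
{ intros f x y Hf; destruct (Rtotal_order x y) as [H | [H | H]].
  - apply (eq_is_derive f x y); trivial.
    intros t Ht; apply Hf; rewrite Rmin_left, Rmax_right; lra.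
  - now rewrite H.
  - symmetry; apply (eq_is_derive f y x); trivial.
    intros t Ht; apply Hf; rewrite Rmin_right, Rmax_left; lra. }
intros u v u' v' [Ha Hb] [Ha' Hb']; transitivity (g u' v).
- apply (line (fun t => g t v)); intros t Ht.
  assert (Hin : strip a b t v).
  { split.
    - apply Rbar_lt_le_trans with (Rmin u u'); [|apply Ht].
      unfold Rmin; destruct Rle_dec; assumption.
    - apply Rbar_le_lt_trans with (Rmax u u'); [apply Ht|].
      unfold Rmax; destruct Rle_dec; assumption. }
  destruct (Hg i1 t v Hin) as [Hex H0]; simpl in Hex, H0.
  rewrite <- H0; now apply Derive_correct.
- apply (line (fun t => g u' t)); intros t _.
  destruct (Hg i2 u' t (conj Ha' Hb')) as [Hex H0]; simpl in Hex, H0.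
  rewrite <- H0; now apply Derive_correct.
Qed.

(** Supplies the base point at which the additive constant of a potential is read off. *)
Lemma Rbar_dense (a b : Rbar) :
  Rbar_lt a b -> exists u : R, Rbar_lt a u /\ Rbar_lt u b.
Proof.
destruct a as [a | |], b as [b | |]; simpl; try easy; intros H.
- exists ((a + b) / 2); lra.
- exists (a + 1); lra.
- exists (b - 1); lra.
- now exists 0.
Qed.

Lemma same_partials_iff (a b : Rbar) (p tau : R -> R -> R) :
  Rbar_lt a b ->
  (forall i u v, strip a b u v -> ex_partial i p u v) ->
  (forall i u v, strip a b u v ->
     ex_partial i tau u v /\ partial i tau u v = partial i p u v) <->
  exists c : R, forall u v, strip a b u v -> tau u v = p u v + c.
Proof.
intros Hab Hp; split.
- intros Htau.
  assert (Hconst : forall i u v, strip a b u v ->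
    ex_partial i (fun u v => tau u v + -1 * p u v) u v /\
    partial i (fun u v => tau u v + -1 * p u v) u v = 0).
  { intros i u v Huv; destruct (Htau i u v Huv) as [Hext Ht].
    destruct (partial_const i (-1) u v) as [Hex0 H0].
    destruct (partial_mult i (fun _ _ => -1) p u v Hex0 (Hp i u v Huv))
      as [Hex1 H1].
    destruct (partial_plus i tau _ u v Hext Hex1) as [Hex H].
    split; [exact Hex | rewrite H, H1, H0, Ht; ring]. }
  destruct (Rbar_dense a b Hab) as [u0 Hu0].
  (* The constant is the value of the difference at the base point (u0, 0). *)
  exists (tau u0 0 + -1 * p u0 0); intros u v Huv.
  rewrite <- (partial_zero_const a b _ Hconst u v u0 0 Huv Hu0); ring.
- intros [c Hc] i u v Huv.
  destruct (partial_const i c u v) as [Hex0 H0].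
  destruct (partial_plus i p _ u v (Hp i u v Huv) Hex0) as [Hex H].
  destruct (partial_ext_on (strip a b) i (fun u v => p u v + c) tau u v
    (strip_open a b) (fun u v Huv => eq_sym (Hc u v Huv)) Huv) as [Hext Ht].
  split; [exact (Hext Hex) | rewrite <- Ht, H, H0; ring].
Qed.

(** * Vector algebra in three dimensions *)

Ltac vec_unfold :=
  (* Derivatives stay folded, so that [ring] treats their coordinates as atoms. *)
  cbv -[fst snd Rplus Rmult Ropp Rinv IZR Rle Rlt pow nvec vDerive not];
  cbn [fst snd].

Lemma vec_ext (x y : vec) : c1 x = c1 y -> c2 x = c2 y -> c3 x = c3 y -> x = y.
Proof.
destruct x as [[x1 x2] x3], y as [[y1 y2] y3]; cbn; intros; now subst.
Qed.

Lemma dot_plus_r (x y z : vec) : dot x (plus y z) = dot x y + dot x z.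
Proof. vec_unfold; ring. Qed.

Lemma dot_scal_r (c : R) (x y : vec) : dot x (scal c y) = c * dot x y.
Proof. vec_unfold; ring. Qed.

Lemma dot_scal_l (c : R) (x y : vec) : dot (scal c x) y = c * dot x y.
Proof. vec_unfold; ring. Qed.

Lemma dot_zero_r (x : vec) : dot x zero = 0.
Proof. vec_unfold; ring. Qed.

Lemma vnorm_1 (x : vec) : vnorm x = 1 -> dot x x = 1.
Proof.
intros H; apply sqrt_lem_0 in H; [lra| |lra].
vec_unfold; nra.
Qed.

(** For x = s' this is the equation s' = δλ e + δ z of the striction curve. *)
Lemma frame_expansion (e n x : vec) :
  dot e e = 1 -> dot n n = 1 -> dot e n = 0 -> dot x n = 0 ->
  x = plus (scal (dot x e) e) (scal (triple x e n) (cross e n)).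
Proof.
intros He Hn Hen Hxn.
(* Cramer's rule for e, n and e × n, a polynomial identity valid for all vectors; the factor of x is
   the Gram determinant of e and n, which is 1 here. *)
assert (H : scal (dot e e * dot n n - dot e n ^ 2) x =
  plus (plus (scal (dot x e * dot n n - dot x n * dot e n) e)
             (scal (dot x n * dot e e - dot x e * dot e n) n))
       (scal (triple x e n) (cross e n)))
  by (apply vec_ext; vec_unfold; ring).
rewrite He, Hn, Hen, Hxn in H.
apply (f_equal (fun w => (c1 w, c2 w, c3 w))) in H.
injection H; intros H3 H2 H1.
apply vec_ext; revert H1 H2 H3; vec_unfold; lra.
Qed.

(** Pairing a linear relation with [N] isolates the coefficient of [y]. If [dot N y] were nonzero,
    this coefficient and then the other two would vanish, against the linear dependence. *)
Lemma rank_2_orthogonal (x1 x2 y N : vec) :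
  lin_indep2 x1 x2 -> dot N x1 = 0 -> dot N x2 = 0 -> rank_2 x1 x2 y ->
  dot N y = 0.
Proof.
intros Hind H1 H2 [Hdep _].
destruct (Req_dec (dot N y) 0) as [H | H]; trivial.
exfalso; apply Hdep; intros p q t Hpqt.
assert (Ht : t = 0).
{ apply (f_equal (dot N)) in Hpqt.
  rewrite !dot_plus_r, !dot_scal_r, H1, H2, dot_zero_r in Hpqt.
  apply (Rmult_eq_reg_r (dot N y)); trivial; lra. }
subst t.
destruct (Hind p q) as [Hp Hq]; auto.
rewrite <- Hpqt; apply vec_ext; vec_unfold; ring.
Qed.

(** * Regularity of vector-valued maps and of their products *)

Lemma Ck_dot (k : nat) (U : R -> R -> Prop) (f g : R -> R -> vec) :
  open_2d U -> vCk k U f -> vCk k U g ->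
  Ck k U (fun u v => dot (f u v) (g u v)).
Proof.
intros HU (Hf1 & Hf2 & Hf3) (Hg1 & Hg2 & Hg3).
unfold dot; auto 6 using Ck_plus, Ck_mult.
Qed.

Lemma vCk_cross (k : nat) (U : R -> R -> Prop) (f g : R -> R -> vec) :
  open_2d U -> vCk k U f -> vCk k U g ->
  vCk k U (fun u v => cross (f u v) (g u v)).
Proof.
intros HU (Hf1 & Hf2 & Hf3) (Hg1 & Hg2 & Hg3).
unfold vCk, cross; cbn; auto 8 using Ck_minus, Ck_mult.
Qed.

Lemma vCk_le (k n : nat) (U : R -> R -> Prop) (f : R -> R -> vec) :
  open_2d U -> (k <= n)%nat -> vCk n U f -> vCk k U f.
Proof.
intros HU Hkn (Hf1 & Hf2 & Hf3).
repeat split; apply (Ck_le k n); assumption.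
Qed.

Lemma vCk_vDerive (k : nat) (U : R -> R -> Prop) (f : R -> vec) :
  vCk (S k) U (fun u _ => f u) -> vCk k U (fun u _ => vDerive f u).
Proof.
intros (Hf1 & Hf2 & Hf3).
exact (conj (proj2 (Hf1 i1)) (conj (proj2 (Hf2 i1)) (proj2 (Hf3 i1)))).
Qed.

Lemma partial_dot (U : R -> R -> Prop) (f g : R -> R -> vec) (i : idx)
    (u v : R) :
  vCk 1 U f -> vCk 1 U g -> U u v ->
  partial i (fun u v => dot (f u v) (g u v)) u v =
  dot (vpartial i f u v) (g u v) + dot (f u v) (vpartial i g u v).
Proof.
intros (Hf1 & Hf2 & Hf3) (Hg1 & Hg2 & Hg3) Huv.
destruct (partial_mult i (fun u v => c1 (f u v)) (fun u v => c1 (g u v)) u v)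
  as [Hex1 Hd1]; [now apply Hf1 | now apply Hg1 |].
destruct (partial_mult i (fun u v => c2 (f u v)) (fun u v => c2 (g u v)) u v)
  as [Hex2 Hd2]; [now apply Hf2 | now apply Hg2 |].
destruct (partial_mult i (fun u v => c3 (f u v)) (fun u v => c3 (g u v)) u v)
  as [Hex3 Hd3]; [now apply Hf3 | now apply Hg3 |].
destruct (partial_plus i _ _ u v Hex1 Hex2) as [Hex12 Hd12].
destruct (partial_plus i _ _ u v Hex12 Hex3) as [_ Hd].
unfold dot; rewrite Hd, Hd12, Hd1, Hd2, Hd3; cbn; ring.
Qed.

(* This gains one order over the regularity of [y]: when a partial derivative of
   the dot product is taken, only [N] is effectively differentiated. *)
Lemma Ck_dot_tangential (k : nat) (U : R -> R -> Prop) (N y : R -> R -> vec) :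
  open_2d U -> vCk (S (S k)) U N -> vCk (S k) U y ->
  (forall i u v, U u v -> dot (N u v) (vpartial i y u v) = 0) ->
  Ck (S (S k)) U (fun u v => dot (N u v) (y u v)).
Proof.
intros HU HN Hy Htan i.
assert (Hdot : Ck (S k) U (fun u v => dot (N u v) (y u v))).
{ apply Ck_dot; trivial; apply vCk_le with (S (S k)); auto. }
split; [exact (proj1 (Hdot i))|].
apply (Ck_ext (S k) U (fun u v => dot (vpartial i N u v) (y u v))); trivial.
- intros u v Huv; rewrite (partial_dot U), Htan; trivial.
  + ring.
  + apply vCk_le with (S (S k)); trivial; lia.
  + apply vCk_le with (S k); trivial; lia.
- apply Ck_dot; trivial.
  destruct HN as (HN1 & HN2 & HN3).
  exact (conj (proj2 (HN1 i)) (conj (proj2 (HN2 i)) (proj2 (HN3 i)))).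
Qed.

(** * Smoothness and tangent vectors of a ruled surface *)

Lemma ruled_Ck (k : nat) (a b : Rbar) (f g : R -> R) :
  Ck k (strip a b) (fun u v => f u + v * g u) ->
  Ck k (strip a b) (fun u _ => f u) /\ Ck k (strip a b) (fun u _ => g u).
Proof.
intros H; pose proof (strip_open a b) as HU.
(* The slice v = 0 is f; subtracting it from the slice v = 1 leaves g. *)
assert (Hf : Ck k (strip a b) (fun u _ => f u)).
{ apply (Ck_ext k _ (fun u _ => f u + 0 * g u)); trivial.
  - intros; ring.
  - exact (Ck_slice k a b _ 0 H). }
split; trivial.
apply (Ck_ext k _ (fun u _ => (f u + 1 * g u) - f u)); trivial.
- intros; ring.
- apply Ck_minus; trivial; exact (Ck_slice k a b _ 1 H).
Qed.

Lemma ruled_vCk (k : nat) (a b : Rbar) (s e : R -> vec) :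
  vCk k (strip a b) (surf s e) ->
  vCk k (strip a b) (fun u _ => s u) /\ vCk k (strip a b) (fun u _ => e u).
Proof.
intros (H1 & H2 & H3).
apply ruled_Ck in H1; apply ruled_Ck in H2; apply ruled_Ck in H3.
repeat split; tauto.
Qed.

Lemma vpartial_surf_1 (a b : Rbar) (s e : R -> vec) (u v : R) :
  vCk 1 (strip a b) (fun u _ => s u) -> vCk 1 (strip a b) (fun u _ => e u) ->
  strip a b u v ->
  vpartial i1 (surf s e) u v = plus (vDerive s u) (scal v (vDerive e u)).
Proof.
intros (Hs1 & Hs2 & Hs3) (He1 & He2 & He3) Huv.
assert (scalar : forall f g : R -> R,
  Ck 1 (strip a b) (fun u _ => f u) -> Ck 1 (strip a b) (fun u _ => g u) ->
  Derive (fun t => f t + v * g t) u = Derive f u + v * Derive g u).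
{ intros f g Hf Hg.
  pose proof (proj1 (Hf i1) u v Huv); pose proof (proj1 (Hg i1) u v Huv).
  rewrite Derive_plus; trivial.
  - now rewrite Derive_scal.
  - now apply ex_derive_scal. }
apply vec_ext.
- exact (scalar (fun u => c1 (s u)) (fun u => c1 (e u)) Hs1 He1).
- exact (scalar (fun u => c2 (s u)) (fun u => c2 (e u)) Hs2 He2).
- exact (scalar (fun u => c3 (s u)) (fun u => c3 (e u)) Hs3 He3).
Qed.

Lemma vpartial_surf_2 (s e : R -> vec) (u v : R) :
  vpartial i2 (surf s e) u v = e u.
Proof.
assert (scalar : forall x y : R, Derive (fun t => x + t * y) v = y).
{ intros x y; apply is_derive_unique; auto_derive; trivial; ring. }
apply vec_ext; apply scalar.
Qed.

(** Differentiate ⟨e, e⟩ = 1. *)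
Lemma unit_field_orthogonal (a b : Rbar) (e : R -> vec) (u v : R) :
  vCk 1 (strip a b) (fun u _ => e u) ->
  (forall u : R, Rbar_lt a u -> Rbar_lt u b -> vnorm (e u) = 1) ->
  strip a b u v -> dot (e u) (vDerive e u) = 0.
Proof.
intros He Hunit Huv.
pose proof (partial_dot (strip a b) _ _ i1 u v He He Huv) as H; cbv beta in H.
(* The left side becomes the derivative of the constant 1, since ⟨e, e⟩ = 1 on the whole open
   strip. *)
rewrite <- (proj2 (partial_ext_on _ i1 (fun _ _ => 1) _ u v (strip_open a b)
  (fun u v Huv => eq_sym (vnorm_1 _ (Hunit u (proj1 Huv) (proj2 Huv)))) Huv)),
  (proj2 (partial_const i1 1 u v)) in H.
change (vpartial i1 (fun u _ => e u) u v) with (vDerive e u) in H.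
unfold dot in *; lra.
Qed.

(** [unit_normal] without the factor [/ w], so that orthogonality reduces to polynomial
    identities. *)
Definition normal (s e : R -> vec) (u v : R) : vec :=
  minus (scal (distr s e u) (nvec e u)) (scal v (zvec e u)).

(** * Frame, normal and distribution parameter of a skew ruled surface *)

Section SkewRuledSurface.

Context (r k : nat) (a b : Rbar) (s e : R -> vec) (y : R -> R -> vec)
  (hr : (3 <= r)%nat) (hk : (1 <= k < r)%nat)
  (hsurf : skew_ruled_surface s e r a b)
  (hnorm : relative_normalization s e k a b y) (hpolar : polar e a b y).

Let HU : open_2d (strip a b) := strip_open a b.

Lemma base_smooth :
  vCk 3 (strip a b) (fun u _ => s u) /\ vCk 3 (strip a b) (fun u _ => e u).
Proof using r hr hsurf.
apply ruled_vCk, vCk_le with r; auto; apply hsurf.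
Qed.

Lemma frame_orthonormal (u v : R) : strip a b u v ->
  dot (e u) (e u) = 1 /\ dot (nvec e u) (nvec e u) = 1 /\
  dot (e u) (nvec e u) = 0 /\ dot (vDerive s u) (nvec e u) = 0.
Proof using r hr hsurf.
intros Huv; destruct hsurf as [_ _ _ _ Hunit Hunit' Hstr _].
destruct Huv as [Ha Hb]; repeat split.
- apply vnorm_1, (Hunit u); auto.
- apply vnorm_1, (Hunit' u); auto.
- apply (unit_field_orthogonal a b e u v); [|intros t; apply (Hunit t)|split; auto].
  apply vCk_le with 3%nat; auto; apply base_smooth.
- apply (Hstr u); auto.
Qed.

Lemma normal_orthogonal (i : idx) (u v : R) : strip a b u v ->
  dot (normal s e u v) (vpartial i (surf s e) u v) = 0.
Proof using r hr hsurf.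
intros Huv.
destruct (frame_orthonormal u v Huv) as (_ & Hnn & Hen & Hsn).
destruct i.
- rewrite (vpartial_surf_1 a b) by
    (trivial; apply vCk_le with 3%nat; auto; apply base_smooth).
  change (vDerive e u) with (nvec e u).
  (* Here ⟨z, n⟩ = 0, and ⟨z, s'⟩ is the triple product defining δ; this yields the -1 in the second
     term. *)
  transitivity (distr s e u * dot (vDerive s u) (nvec e u)
    + v * distr s e u * (dot (nvec e u) (nvec e u) - 1)).
  + unfold normal, zvec, distr; fold (nvec e u); vec_unfold; ring.
  + rewrite Hnn, Hsn; ring.
- rewrite vpartial_surf_2.
  transitivity (distr s e u * dot (e u) (nvec e u)).
  + unfold normal, zvec; vec_unfold; ring.
  + rewrite Hen; ring.
Qed.

Lemma det_fund2_neq_0 (u v : R) : strip a b u v ->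
  det2 (fund2 s e) u v <> 0.
Proof using r hsurf.
intros Huv H; apply (srs_curvature s e r a b hsurf u v Huv).
unfold gauss_curv; rewrite H; unfold Rdiv; ring.
Qed.

(* If the distribution parameter vanished at [u], so would the normal vector at
   [(u, 0)], and with it the second fundamental form. *)
Lemma distr_neq_0 (u v : R) : strip a b u v -> distr s e u <> 0.
Proof using r hsurf.
intros Huv H; apply (det_fund2_neq_0 u 0 Huv).
assert (H0 : unit_normal s e u 0 = zero)
  by (apply vec_ext; unfold unit_normal; rewrite H; vec_unfold; ring).
assert (Hz : forall x, dot zero x = 0) by (intros; vec_unfold; ring).
unfold det2, fund2; rewrite H0, !Hz; ring.
Qed.

Lemma w_sqr_pos (u v : R) : strip a b u v -> 0 < distr s e u ^ 2 + v ^ 2.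
Proof using r hsurf.
intros Huv; pose proof (distr_neq_0 u v Huv); nra.
Qed.

Lemma w_neq_0 (u v : R) : strip a b u v -> w s e u v <> 0.
Proof using r hsurf.
intros Huv; apply Rgt_not_eq, sqrt_lt_R0, (w_sqr_pos u v Huv).
Qed.

(** * The support function: nonvanishing and regularity *)

Lemma support_normal (u v : R) :
  support s e y u v = / w s e u v * dot (normal s e u v) (y u v).
Proof. apply dot_scal_l. Qed.

(* A vector [p n + t z] orthogonal to the normal [delta n - v z] is parallel to
   [v n + delta z], which is tangential: it is the u-derivative of the surface
   minus a multiple of [e]. *)
Lemma support_neq_0 (u v : R) : strip a b u v -> support s e y u v <> 0.
Proof using r k hr hsurf hnorm hpolar.
intros Huv Hq.
assert (HN : dot (normal s e u v) (y u v) = 0).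
{ rewrite support_normal in Hq; apply Rmult_integral in Hq as [Hq | Hq]; trivial.
  destruct (Rinv_neq_0_compat _ (w_neq_0 u v Huv) Hq). }
destruct (frame_orthonormal u v Huv) as (Hee & Hnn & Hen & Hsn).
destruct (hpolar u v Huv) as (p & t & Hy).
pose proof (frame_expansion _ _ _ Hee Hnn Hen Hsn) as Hs.
change (triple (vDerive s u) (e u) (nvec e u)) with (distr s e u) in Hs.
assert (Hpt : distr s e u * p = v * t).
{ rewrite Hy in HN.
  assert (Hzz : dot (zvec e u) (zvec e u) = 1).
  { transitivity (dot (e u) (e u) * dot (nvec e u) (nvec e u)
      - dot (e u) (nvec e u) ^ 2).
    - unfold zvec; vec_unfold; ring.
    - rewrite Hee, Hnn, Hen; ring. }
  assert (H : dot (normal s e u v)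
      (plus (scal p (nvec e u)) (scal t (zvec e u))) =
    distr s e u * p * dot (nvec e u) (nvec e u)
    - v * t * dot (zvec e u) (zvec e u))
    by (unfold normal, zvec; vec_unfold; ring).
  rewrite Hnn, Hzz, HN in H; lra. }
pose proof (rn_transversal s e k a b y hnorm u v Huv) as Hind.
rewrite vpartial_surf_2, (vpartial_surf_1 a b) in Hind by
  (trivial; apply vCk_le with 3%nat; auto; apply base_smooth).
change (vDerive e u) with (nvec e u) in Hind.
(* Since s' = ⟨s', e⟩ e + δ z, these coefficients leave the vector (v t - δ p) n, which is zero by
   [Hpt]; independence then forces the last coefficient -δ to vanish. *)
destruct (Hind t (- t * dot (vDerive s u) (e u)) (- distr s e u))
  as (_ & _ & Hd).
- rewrite Hy, Hs at 1.
  transitivity (scal (v * t - distr s e u * p) (nvec e u)).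
  + change (zvec e u) with (cross (e u) (nvec e u)).
    apply vec_ext; vec_unfold; ring.
  + rewrite Hpt; apply vec_ext; vec_unfold; ring.
- apply (distr_neq_0 u v Huv); lra.
Qed.

(** The curves s and e are C^3, and δ, n and z involve only their first derivatives. As δ^2 + v^2 is
    positive, the root and the inverse cost no further order. *)
Lemma unit_normal_smooth : vCk 2 (strip a b) (unit_normal s e).
Proof using r hr hsurf.
destruct base_smooth as [Hs He].
pose proof (vCk_vDerive 2 _ s Hs) as Hs'.
pose proof (vCk_vDerive 2 _ e He) as Hn.
apply (vCk_le 2 3) in He; auto.
pose proof (vCk_cross 2 _ _ _ HU He Hn) as Hz.
pose proof (Ck_dot 2 _ _ _ HU Hs' Hz) as Hd.
change (Ck 2 (strip a b) (fun u _ => distr s e u)) in Hd.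
pose proof (Ck_coord2 2 _ HU) as Hv.
assert (Hw : Ck 2 (strip a b) (fun u v => / w s e u v)).
{ apply Ck_inv; trivial; [exact w_neq_0|].
  apply Ck_sqrt; trivial; [exact w_sqr_pos|].
  unfold pow; apply Ck_plus; trivial;
    repeat apply Ck_mult; trivial; now apply Ck_const. }
destruct Hn as (Hn1 & Hn2 & Hn3), Hz as (Hz1 & Hz2 & Hz3).
assert (scalar : forall f g : R -> R -> R,
  Ck 2 (strip a b) f -> Ck 2 (strip a b) g ->
  Ck 2 (strip a b)
    (fun u v => / w s e u v * (distr s e u * f u v - v * g u v))).
{ intros f g Hf Hg; apply Ck_mult; trivial; apply Ck_minus; trivial;
    apply Ck_mult; trivial. }
exact (conj (scalar _ _ Hn1 Hz1) (conj (scalar _ _ Hn2 Hz2)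
  (scalar _ _ Hn3 Hz3))).
Qed.

Lemma support_smooth : Ck 2 (strip a b) (support s e y).
Proof using r k hr hk hsurf hnorm.
apply Ck_dot_tangential; trivial.
- exact unit_normal_smooth.
- apply vCk_le with k; trivial; [lia | apply hnorm].
(* The rank condition puts the derivatives of [y] into the tangent plane, to which the unit normal
   is orthogonal. *)
- intros i u v Huv; apply (rank_2_orthogonal
    (vpartial i1 (surf s e) u v) (vpartial i2 (surf s e) u v)).
  + now apply (srs_immersion s e r a b hsurf).
  + unfold unit_normal; rewrite dot_scal_l; fold (normal s e u v).
    rewrite (normal_orthogonal i1 u v Huv); ring.
  + unfold unit_normal; rewrite dot_scal_l; fold (normal s e u v).
    rewrite (normal_orthogonal i2 u v Huv); ring.
  + now apply (rn_tangent s e k a b y hnorm).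
Qed.

(** * The relative metric, its gradients, and the curl *)

Lemma det_relG_neq_0 (u v : R) : strip a b u v ->
  det2 (relG s e y) u v <> 0.
Proof using r k hr hsurf hnorm hpolar.
intros Huv.
(* As G = h / q, the determinant acquires the factor q^(-2). *)
replace (det2 (relG s e y) u v) with
  (/ support s e y u v * / support s e y u v * det2 (fund2 s e) u v)
  by (unfold det2, relG; ring).
pose proof (Rinv_neq_0_compat _ (support_neq_0 u v Huv)).
repeat apply Rmult_integral_contrapositive_currified; trivial.
now apply det_fund2_neq_0.
Qed.

(** [relG_inv] is the adjugate matrix over the determinant, so lowering the index cancels it.
    Gradients can thus be compared through plain partial derivatives. *)
Lemma lower_grad_G (f : R -> R -> R) (i : idx) (u v : R) : strip a b u v ->
  lower_G s e y (grad_G s e y f) i u v = partial i f u v.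
Proof using r k hr hsurf hnorm hpolar.
intros Huv; pose proof (det_relG_neq_0 u v Huv) as Hdet.
unfold lower_G, grad_G, sum_idx, relG_inv, det2 in *.
destruct i; field; exact Hdet.
Qed.

(** Written with the factor [/ 4] in front as in [Q], so that [Derive_scal] extracts it. *)
Let potential (u v : R) : R := / 4 * (1 / support s e y u v).

Lemma potential_smooth : Ck 2 (strip a b) potential.
Proof using r k hr hk hsurf hnorm hpolar.
apply Ck_mult; auto using Ck_const.
apply Ck_mult; auto using Ck_const.
apply Ck_inv; trivial; [exact support_neq_0 | exact support_smooth].
Qed.

Lemma Q_grad_potential (i : idx) (u v : R) : strip a b u v ->
  Q s e y i u v = grad_G s e y potential i u v.
Proof using r k hr hk hsurf hnorm hpolar.
intros Huv.
assert (H : forall j, partial j potential u v =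
  / 4 * partial j (fun u v => 1 / support s e y u v) u v)
  by (intros [|]; apply Derive_scal).
unfold Q, grad_G, sum_idx; rewrite !H; ring.
Qed.

Lemma lower_Q (i : idx) (u v : R) : strip a b u v ->
  lower_G s e y (Q s e y) i u v = partial i potential u v.
Proof using r k hr hk hsurf hnorm hpolar.
intros Huv; rewrite <- lower_grad_G by trivial.
unfold lower_G, sum_idx; now rewrite !Q_grad_potential.
Qed.

Lemma curl_Q (u v : R) : strip a b u v ->
  curl_exists s e y (Q s e y) u v /\ curl_G s e y (Q s e y) u v = 0.
Proof using r k hr hk hsurf hnorm hpolar.
intros Huv; pose proof potential_smooth as Hp.
(* [lower_Q] holds on the whole open strip, so it may be differentiated; existence of the
   derivatives carries over from the C^2 function [potential]. *)
destruct (partial_ext_on _ i1 (partial i2 potential)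
  (lower_G s e y (Q s e y) i2) u v HU) as [Hex1 H1]; trivial.
{ intros; symmetry; now apply lower_Q. }
destruct (partial_ext_on _ i2 (partial i1 potential)
  (lower_G s e y (Q s e y) i1) u v HU) as [Hex2 H2]; trivial.
{ intros; symmetry; now apply lower_Q. }
split.
- split; [apply Hex1 | apply Hex2]; apply Hp; trivial.
- unfold curl_G; rewrite <- H1, <- H2, (Ck_schwarz (strip a b)) by trivial.
  unfold Rdiv; ring.
Qed.

(** Partial derivatives determine the gradient, and lowering the index recovers them from it. So
    [tau] is a potential exactly when it has the partial derivatives of [potential], and
    [same_partials_iff] applies. *)
Lemma potential_iff (tau : R -> R -> R) :
  is_potential s e y a b (Q s e y) tau <->
  exists c : R, forall u v, strip a b u v -> tau u v = potential u v + c.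
Proof using r k hr hk hsurf hnorm hpolar.
rewrite <- same_partials_iff;
  [| apply hsurf | intros i; exact (proj1 (potential_smooth i))].
split; intros Htau i u v Huv; split; try exact (proj1 (Htau i u v Huv)).
- rewrite <- lower_Q, <- lower_grad_G by trivial.
  unfold lower_G, sum_idx.
  now rewrite (proj2 (Htau i1 u v Huv)), (proj2 (Htau i2 u v Huv)).
- rewrite Q_grad_potential by trivial; unfold grad_G, sum_idx.
  now rewrite (proj2 (Htau i1 u v Huv)), (proj2 (Htau i2 u v Huv)).
Qed.

End SkewRuledSurface.

Theorem proposition4p3 (r k : nat) (a b : Rbar) (s e : R -> vec)
    (y : R -> R -> vec)
    (hr : (3 <= r)%nat)
    (hk : (1 <= k < r)%nat)
    (hsurf : skew_ruled_surface s e r a b)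
    (hnorm : relative_normalization s e k a b y)
    (hpolar : polar e a b y) :
  (forall u v : R, strip a b u v ->
     curl_exists s e y (Q s e y) u v /\
     curl_G s e y (Q s e y) u v = 0) /\
  (forall tau : R -> R -> R,
     is_potential s e y a b (Q s e y) tau <->
     exists c : R, forall u v : R, strip a b u v ->
       tau u v = 1 / (4 * support s e y u v) + c).
Proof.
split.
- intros u v; eapply curl_Q; eassumption.
- intros tau; rewrite potential_iff by eassumption.
  (* Passing between [/ 4 * (1 / q)] and [1 / (4 * q)] by [field] calls for q to be nonzero. *)
  split; intros [c Hc]; exists c; intros u v Huv; rewrite Hc by trivial; field;
    eapply support_neq_0; eassumption.
Qed.
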